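(* Let $p\in[1,\infty)$, let $r$ be a positive integer, and let $\mathbb{X},\mathbb{Y},\mathbb{Z}$ be metric measure spaces whose measures have finite support. Then the quantity $\Delta_{p,r}$ defined in the context satisfies the triangle inequality $$\Delta_{p,r}(\mathbb{X},\mathbb{Z})\le\Delta_{p,r}(\mathbb{X},\mathbb{Y})+\Delta_{p,r}(\mathbb{Y},\mathbb{Z}).$$
   Context: **Setting.** A metric measure space $\mathbb{X}=(\mathcal X,d_{\mathcal X},\mu_{\mathcal X})$ is a metric space with a probability measure. All measures are finitely supported. For $\mathbb{X}$ with $\mu_{\mathcal X}$ supported on $\{x_1,\dots,x_m\}$ and $\mathbb{Y}$ with $\mu_{\mathcal Y}$ supported on $\{y_1,\dots,y_n\}$, identify $\mu_{\mathcal X},\mu_{\mathcal Y}$ with probability vectors $\alpha\in\mathbb{R}^m$, $\beta\in\mathbb{R}^n$. Here $[m]=\{1,\dots,m\}$, $[m\times n]=[m]\times[n]$. **Moment and localizing matrices.** Let $\mathbb{N}^{N}_{t}$ be the set of multi-indices $\tau\in\mathbb{N}^N$ with $|\tau|\le t$, and $s(N,t)=\binom{N+t}{t}$. A sequence $z\in\mathbb{R}^{s(N,2t)}$ is indexed by $\mathbb{N}^N_{2t}$ (equivalently, by monomials of degree at most $2t$). For $g=\sum_\gamma g_\gamma x^\gamma$, $\mathbf{M}_s(gz)$ has rows and columns indexed by $\mathbb{N}^N_s$ and entries $\mathbf{M}_s(gz)(\tau,\sigma)=\sum_\gamma g_\gamma z_{\gamma+\tau+\sigma}$. **Feasible set.**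 In variables $\pi=(\pi_{ij})\in\mathbb{R}^{m\times n}$ let $e_{ij}=\pi_{ij}$, $r_i=\sum_j\pi_{ij}-\alpha_i$, $c_j=\sum_i\pi_{ij}-\beta_j$, and for $I\subset[m\times n]$ let $e_I=\prod_{(i,j)\in I}\pi_{ij}$ ($e_\emptyset=1$), $d_I=\lceil\deg e_I/2\rceil$. $\Pi_r(\alpha,\beta)$ is the set of $z\in\mathbb{R}^{s(mn,2r)}$ such that $z_0=1$; $\mathbf{M}_{r-d_I}(e_Iz)\succeq0$ for all $I\subset[m\times n]$ with $\deg e_I\le2r$; $\mathbf{M}_{r-1}(r_iz)=0$, $\mathbf{M}_{r-1}(c_jz)=0$, $\mathbf{M}_{r-1}(r_{i_1}e_{i_2j}z)=0$ and $\mathbf{M}_{r-1}(c_{j_1}e_{ij_2}z)=0$ for all $i,i_1,i_2\in[m]$, $j,j_1,j_2\in[n]$. **The distance.** $$\Delta_{p,r}(\mathbb{X},\mathbb{Y})=\Big(\min_{z\in\Pi_r(\alpha,\beta)}\ \sum_{i,k\in[m],\,j,l\in[n]}|d_{\mathcal X}(x_i,x_k)-d_{\mathcal Y}(y_j,y_l)|^p\,z_{ij,kl}\Big)^{1/p},$$ where $z_{ij,kl}$ is the component of $z$ indexed by the monomial $\pi_{ij}\pi_{kl}$. $\Delta_{p,r}$ for the other pairs of spaces is defined in the same way. *)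

(* Defs.v *)
From HB Require Import structures.
From mathcomp Require Import all_boot all_order all_algebra.
From mathcomp Require Import all_classical all_reals all_analysis.
(* The notations of mpoly clash with those of MathComp-Analysis, so the names
   are used directly: [multinom N] is the type of multi-indices in N^N,
   [bmultinom N b] that of multi-indices of degree < b, [mpoly N R] that of
   polynomials in N variables. *)
From mathcomp Require Import -(notations) mpoly.

Set Implicit Arguments.
Unset Strict Implicit.
Unset Printing Implicit Defensive.

Import Order.TTheory GRing.Theory Num.Theory.
Import numFieldNormedType.Exports.

Local Open Scope classical_set_scope.
Local Open Scope ring_scope.

(* Generated sigma-algebras are only available on pointed types; a space
   carrying a probability measure is nonempty, so nothing is lost. *)
#[short(type="pmetricType")]
HB.structure Definition PMetric (K : numDomainType) :=
  { M of Metric K M & Pointed M }.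

Definition borel (R : realType) (T : pmetricType R) :=
  g_sigma_algebraType (@open T).

(* Metric measure space with a Borel probability measure supported on the
   finite set {mm_pt 0, ..., mm_pt (mm_card - 1)}, with a chosen enumeration
   of that set. *)
Record mmSpace (R : realType) := MMSpace {
  mm_carrier : pmetricType R ;
  mm_measure : probability (borel mm_carrier) R ;
  mm_card : nat ;
  mm_pt : 'I_mm_card -> mm_carrier ;
  mm_pt_inj : injective mm_pt ;
  mm_supported : mm_measure (range mm_pt) = 1%E
}.

Definition mm_weight (R : realType) (X : mmSpace R) (i : 'I_(mm_card X)) : R :=
  fine (@mm_measure R X [set mm_pt i]).

Definition mm_dist (R : realType) (X : mmSpace R) (i k : 'I_(mm_card X)) : R :=
  mdist (mm_pt i) (mm_pt k).

Section MomentMatrices.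
Variables (R : realType) (N : nat).

Definition momseq (t : nat) := {ffun bmultinom N t.+1 -> R}.

(* z_tau; the value 0 outside the range |tau| <= t is a dummy, never reached by
   the entries of the matrices in [Pi_r]. *)
Definition mom (t : nat) (z : momseq t) (tau : multinom N) : R :=
  if insub tau is Some b then z b else 0.

Definition mnm_of_ord (s : nat) (a : 'I_#|{: bmultinom N s.+1}|) : multinom N :=
  enum_val a.

(* The matrix M_s(gz); its rows and columns are numbered through an enumeration
   of the multi-indices of degree at most s. *)
Definition locmx (t s : nat) (g : mpoly N R) (z : momseq t) :
    'M[R]_#|{: bmultinom N s.+1}| :=
  \matrix_(a, b) \sum_(gamma <- msupp g)
    mcoeff gamma g *
      mom z (mnm_add (mnm_add gamma (mnm_of_ord a)) (mnm_of_ord b)).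

Definition mpoly_deg (g : mpoly N R) : nat := (mmeasure mdeg g).-1.

End MomentMatrices.

Definition psdmx (R : realType) (k : nat) (A : 'M[R]_k) : Prop :=
  A^T = A /\ forall u : 'cV[R]_k, 0 <= (u^T *m A *m u) 0 0.

Section FeasibleSet.
Variables (R : realType) (m n : nat).
Variables (alpha : 'I_m -> R) (beta : 'I_n -> R).

(* The multi-index of the monomial pi_ij. *)
Definition mnm_pi (i : 'I_m) (j : 'I_n) : multinom (m * n) :=
  mnm1 (mxvec_index i j).

Definition e_ (i : 'I_m) (j : 'I_n) : mpoly (m * n) R :=
  mpolyX R (mnm_pi i j).

Definition r_ (i : 'I_m) : mpoly (m * n) R :=
  \sum_(j < n) e_ i j - mpolyC (m * n) (alpha i).

Definition c_ (j : 'I_n) : mpoly (m * n) R :=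
  \sum_(i < m) e_ i j - mpolyC (m * n) (beta j).

Definition eprod (I : {set 'I_m * 'I_n}) : mpoly (m * n) R :=
  \prod_(ij in I) e_ ij.1 ij.2.

Definition Pi_r (r : nat) : set (momseq R (m * n) (2 * r)) :=
  [set z | mom z mnm0 = 1
    /\ (forall I : {set 'I_m * 'I_n}, (mpoly_deg (eprod I) <= 2 * r)%N ->
          psdmx (locmx (r - uphalf (mpoly_deg (eprod I))) (eprod I) z))
    /\ (forall i, locmx (r - 1) (r_ i) z = 0)
    /\ (forall j, locmx (r - 1) (c_ j) z = 0)
    /\ (forall i1 i2 j, locmx (r - 1) (r_ i1 * e_ i2 j) z = 0)
    /\ (forall i j1 j2, locmx (r - 1) (c_ j1 * e_ i j2) z = 0)].

End FeasibleSet.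

Arguments Pi_r {R m n} alpha beta r.

(* The least element of A (0 if there is none). *)
Definition set_min (R : realType) (A : set R) : R :=
  xget 0 [set v | A v /\ lbound A v].

Section Distance.
Variables (R : realType) (p : R) (r : nat).

Definition distortion (X Y : mmSpace R)
    (z : momseq R (mm_card X * mm_card Y) (2 * r)) : R :=
  \sum_(i < mm_card X) \sum_(k < mm_card X)
  \sum_(j < mm_card Y) \sum_(l < mm_card Y)
    `|mm_dist i k - mm_dist j l| `^ p *
      mom z (mnm_add (mnm_pi i j) (mnm_pi k l)).

Definition Delta (X Y : mmSpace R) : R :=
  set_min (@distortion X Y @`
             Pi_r (@mm_weight R X) (@mm_weight R Y) r) `^ p^-1.

End Distance.

(* Main.v *)
(* Evaluating the entries of all the matrices identifies Pi_r with the set of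
   "pseudo-moments" z such that z_0 = 1, such that the kernels
   (tau, sigma) |-> z_(kappa + tau + sigma) are positive, and such that the
   marginal equations hold after multiplication by any monomial of degree
   < 2r.  As in the gluing lemma for couplings, z in Pi_r(alpha, beta) and
   w in Pi_r(beta, gamma) are glued into v in Pi_r(alpha, gamma) by substituting
   pi_ik := \sum_j pi_ij pi_jk / beta_j and applying the functional z (x) w; a
   monomial of degree d goes to monomials of bidegree (d, d), so no moment of
   degree > 2r is needed.  Positivity of the kernels of v follows from the Schur
   product theorem.  Before the sum over j, the second moments of v are
   nonnegative weights indexed by (i, i', j, j', k, k') with the second moments of
   z and w as marginals, so Minkowski's inequality concludes.  The minima are
   attained because Pi_r is nonempty (it contains the moments of the product
   coupling) and compact (all moments are in [0, 1]). *)
Require Import Defs.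
From mathcomp Require Import all_boot all_order all_algebra.
From mathcomp Require Import all_classical all_reals all_analysis.
From mathcomp Require Import -(notations) mpoly.
From mathcomp Require Import ring lra zify.

Import Order.TTheory GRing.Theory Num.Theory.
Import numFieldNormedType.Exports.

Local Open Scope ring_scope.

(** * Positive kernels *)

Section PositiveKernels.
Context {R : realFieldType}.

Definition qform {T : finType} (P : T -> T -> R) (u : T -> R) : R :=
  \sum_x \sum_y u x * u y * P x y.

Definition psd_form {T : finType} (P : T -> T -> R) : Prop :=
  (forall x y, P x y = P y x) /\ forall u, 0 <= qform P u.

(** Moving one coordinate of the test vector makes the form a quadratic polynomial in c; choices of
    c give both the vanishing beside a zero diagonal entry and the positivity of Schur
    complements. *)
Lemma qform_add_delta {T : finType} (P : T -> T -> R) (u : T -> R) (x : T) c :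
    (forall y z, P y z = P z y) ->
  qform P (fun y => u y + c * (y == x)%:R) =
    qform P u + 2 * c * \sum_y u y * P y x + c ^+ 2 * P x x.
Proof.
move=> Psym.
have delta (f : T -> R) : \sum_y (y == x)%:R * f y = f x.
  rewrite (bigD1 x) //= eqxx mul1r big1 ?addr0 // => y /negPf ->.
  by rewrite mul0r.
have -> : qform P (fun y => u y + c * (y == x)%:R) =
    \sum_y \sum_z u y * u z * P y z
    + \sum_y (y == x)%:R * (c * \sum_z u z * P z y)
    + \sum_y u y * (\sum_z (z == x)%:R * (c * P y z))
    + \sum_y (y == x)%:R * (c * (\sum_z (z == x)%:R * (c * P y z))).
  rewrite /qform -!big_split /=; apply: eq_bigr => y _.
  rewrite !mulr_sumr -!big_split /=; apply: eq_bigr => z _.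
  by rewrite (Psym z y); ring.
rewrite !delta -/(qform P u).
under [X in _ + X + _ = _]eq_bigr => y _ do rewrite delta mulrCA.
by rewrite -mulr_sumr; ring.
Qed.

(** Since [P x x = 0], the form at weight 1 on y and t on x is affine in t; being nonnegative for
    all t, it has slope 0. *)
Lemma psd_form_diag0 {T : finType} (P : T -> T -> R) x y :
  psd_form P -> P x x = 0 -> P y x = 0.
Proof.
move=> [Psym Ppos] Pxx.
have Pyx t : 0 <= P y y + 2 * t * P y x.
  have := Ppos (fun z => (z == y)%:R + t * (z == x)%:R).
  rewrite qform_add_delta // Pxx mulr0 addr0.
  rewrite /qform (bigD1 y) //= [X in _ + X + _]big1 ?addr0; last first.
    by move=> z /negPf zy; rewrite big1 // => ? _; rewrite zy !mul0r.
  rewrite (bigD1 y) //= [X in _ + X + _]big1 ?addr0; last first.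
    by move=> z /negPf zy; rewrite zy mulr0 mul0r.
  rewrite (bigD1 y) //= [X in _ * (_ + X)]big1 ?addr0; last first.
    by move=> z /negPf zy; rewrite zy mul0r.
  by rewrite eqxx !mul1r.
(* At this t the affine function would take the value -1. *)
apply/eqP/negPn/negP => nz; have := Pyx (- (P y y + 1) / (2 * P y x)).
suff -> : P y y + 2 * (- (P y y + 1) / (2 * P y x)) * P y x = -1 by lra.
by field.
Qed.

(* Schur product theorem.  Each step splits off a rank-one summand of P by a
   Schur complement, which vanishes on one more diagonal entry. *)
Lemma psd_formM {T : finType} (P Q : T -> T -> R) :
  psd_form P -> psd_form Q -> psd_form (fun x y => P x y * Q x y).
Proof.
move=> psdP [Qsym Qpos]; split=> [x y|u]; first by rewrite psdP.1 Qsym.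
have [N] := ubnP #|[pred x | P x x != 0]|.
elim: N P psdP => // N IH P psdP leN.
have [x Pxx|P0] := pickP [pred x | P x x != 0]; last first.
  rewrite /qform big1 // => x _; rewrite big1 // => y _.
  rewrite (psd_form_diag0 P y x psdP) ?mul0r ?mulr0 //.
  by have /negbFE/eqP := P0 y.
have [Psym Ppos] := psdP; set a := P x x.
have a_neq0 : a != 0 by [].
have a_gt0 : 0 < a.
  rewrite lt_def a_neq0 /=.
  have := Ppos (fun z => (z == x)%:R).
  rewrite /qform (bigD1 x) //= [X in _ + X]big1 ?addr0; last first.
    by move=> z /negPf zx; rewrite big1 // => ? _; rewrite zx !mul0r.
  rewrite (bigD1 x) //= [X in _ + X]big1 ?addr0; last first.
    by move=> z /negPf zx; rewrite zx mulr0 mul0r.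
  by rewrite eqxx !mul1r.
pose P' y z := P y z - a^-1 * P y x * P z x.
have psdP' : psd_form P'.
  split=> [y z|v]; first by rewrite /P' Psym; ring.
  pose S := \sum_y v y * P y x.
  (* The shift [- S / a] minimizes the quadratic polynomial in the coordinate at x, and the minimum
     is the form of [P'] at v. *)
  have := Ppos (fun y => v y + (- S / a) * (y == x)%:R).
  rewrite qform_add_delta // -/S -/a.
  suff -> : qform P' v = qform P v - a^-1 * S * S.
    congr (_ <= _); rewrite -addrA; congr (_ + _); by field.
  rewrite /qform -mulrA {1}/S big_distrl /= mulr_sumr -sumrB.
  apply: eq_bigr => y _; rewrite /S big_distrr mulr_sumr -sumrB /=.
  by apply: eq_bigr => z _; rewrite /P'; ring.
(* Multiplied by Q, the rank-one summand of P amounts to testing Q at the weights [u y * P y x]. *)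
have -> : qform (fun y z => P y z * Q y z) u =
    qform (fun y z => P' y z * Q y z) u
    + a^-1 * qform Q (fun y => u y * P y x).
  rewrite /qform mulr_sumr -big_split /=; apply: eq_bigr => y _.
  rewrite mulr_sumr -big_split /=; apply: eq_bigr => z _.
  by rewrite /P'; ring.
apply: addr_ge0; last by rewrite mulr_ge0 // invr_ge0 ltW.
apply: IH psdP' _; rewrite -ltnS; apply: leq_trans leN; rewrite ltnS.
apply: proper_card; apply/properP; split.
  apply/fintype.subsetP => y; rewrite !inE; apply: contra => /eqP Pyy.
  rewrite /P' Pyy [P y x]Psym (psd_form_diag0 P y x psdP Pyy).
  by rewrite !mulr0 subrr.
exists x; rewrite !inE // /P' -/a negbK; apply/eqP; by field.
Qed.

(* Kernels on an arbitrary index type are tested against finitely supported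
   weights, given as lists of pairs (weight, index). *)
Definition psd_kernel {K : Type} (D : pred K) (P : K -> K -> R) : Prop :=
  forall s : seq (R * K), all (D \o snd) s ->
    0 <= \sum_(x <- s) \sum_(y <- s) x.1 * y.1 * P x.2 y.2.

Lemma psd_kernel_map {K L : Type} (D : pred K) (E : pred L) (f : L -> K) P :
    (forall x, E x -> D (f x)) -> psd_kernel D P ->
  psd_kernel E (fun x y => P (f x) (f y)).
Proof.
move=> DE Ppos s Es.
have := Ppos [seq (x.1, f x.2) | x <- s]; rewrite big_map.
under eq_bigr do rewrite big_map.
by apply; rewrite all_map; apply: sub_all Es => x /DE.
Qed.

(** Positions in the test list serve as the finite index set for the Schur product theorem, so
    repeated indices do no harm. *)
Lemma psd_kernelM {K : Type} (D : pred K) (P Q : K -> K -> R) :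
    (forall x y, P x y = P y x) -> (forall x y, Q x y = Q y x) ->
    psd_kernel D P -> psd_kernel D Q ->
  psd_kernel D (fun x y => P x y * Q x y).
Proof.
move=> Psym Qsym Ppos Qpos [|x0 s'] //; first by rewrite big_nil.
set s := x0 :: s' => Ds; pose k (i : 'I_(size s)) := (nth x0 s i).2.
have psdk (W : K -> K -> R) : (forall x y, W x y = W y x) ->
    psd_kernel D W -> psd_form (fun i j => W (k i) (k j)).
  move=> Wsym Wpos; split=> [i j|u]; first exact: Wsym.
  have := Wpos [seq (u i, k i) | i <- index_enum 'I_(size s)].
  rewrite big_map; under eq_bigr do rewrite big_map.
  apply; rewrite all_map; apply/allP => i _; rewrite /k /=.
  by move/(all_nthP x0): Ds; apply.
have [_ /(_ (fun i => (nth x0 s i).1))] :=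
  psd_formM _ _ (psdk P Psym Ppos) (psdk Q Qsym Qpos).
rewrite (big_nth x0) big_mkord.
by under [in X in _ -> X]eq_bigr do rewrite (big_nth x0) big_mkord.
Qed.

End PositiveKernels.

(** With [t = a / (a + b)], the quotient of f + g by a + b is the convex combination of [f / a] and
    [g / b]. Convexity of the p-th power bounds each term, and both normalized sums are at most
    1. *)
Lemma minkowski_sum {R : realType} {I : finType} (W f g : I -> R) (p a b : R) :
    1 <= p -> (forall i, 0 <= W i) -> (forall i, 0 <= f i) ->
    (forall i, 0 <= g i) -> 0 < a -> 0 < b ->
    \sum_i W i * f i `^ p <= a `^ p -> \sum_i W i * g i `^ p <= b `^ p ->
  \sum_i W i * (f i + g i) `^ p <= (a + b) `^ p.
Proof.
move=> p1 W0 f0 g0 a0 b0 fa gb.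
have p0 : 0 <= p by lra.
have ab0 : 0 < a + b by lra.
pose t := a / (a + b).
have t01 : 0 <= t <= 1.
  apply/andP; split; first by rewrite divr_ge0 ?ltW.
  by rewrite ler_pdivrMr // mul1r lerDl ltW.
have cvx (x y : R) : 0 <= x -> 0 <= y ->
    (t * x + (1 - t) * y) `^ p <= t * x `^ p + (1 - t) * y `^ p.
  move=> x0 y0; have := @convex_powR _ p p1 (Itv01 (andP t01).1 (andP t01).2) x y.
  rewrite !inE /= !in_itv /= !andbT => /(_ x0 y0).
  by rewrite !convRE.
have pw (x c : R) : 0 <= x -> 0 < c -> (x / c) `^ p = x `^ p / c `^ p.
  move=> x0 c0; rewrite powRM ?invr_ge0 ?(ltW c0) //; congr (_ * _).
  apply: (mulfI (x := c `^ p)); first by rewrite gt_eqF ?powR_gt0.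
  rewrite -powRM ?invr_ge0 ?(ltW c0) // !divff ?powR1 ?gt_eqF ?powR_gt0 //.
have key i : W i * (f i + g i) `^ p <=
    (a + b) `^ p * (t * (W i * f i `^ p / a `^ p)
                    + (1 - t) * (W i * g i `^ p / b `^ p)).
  have := cvx (f i / a) (g i / b) (divr_ge0 (f0 i) (ltW a0))
    (divr_ge0 (g0 i) (ltW b0)).
  have -> : t * (f i / a) + (1 - t) * (g i / b) = (f i + g i) / (a + b).
    by rewrite /t; field; rewrite !gt_eqF.
  rewrite !pw ?addr_ge0 // ler_pdivrMr ?powR_gt0 // => h.
  apply: (le_trans (ler_wpM2l (W0 i) h)).
  by rewrite le_eqVlt; apply/orP; left; apply/eqP; ring.
apply: (le_trans (ler_sum _ (fun i _ => key i))).
rewrite -mulr_sumr ler_piMr ?powR_ge0 // big_split /= -!mulr_sumr -!mulr_suml.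
have : (\sum_i W i * f i `^ p) / a `^ p <= 1.
  by rewrite ler_pdivrMr ?powR_gt0 // mul1r.
have : (\sum_i W i * g i `^ p) / b `^ p <= 1.
  by rewrite ler_pdivrMr ?powR_gt0 // mul1r.
move: ((\sum_i W i * f i `^ p) / a `^ p) => x.
move: ((\sum_i W i * g i `^ p) / b `^ p) => y yb xa.
by case/andP: t01 => ? ?; nra.
Qed.

(** * Moment sequences *)

Local Notation "a +m b" := (mnm_add a b) (at level 50, left associativity).

Lemma mxvec_index_inj {m n : nat} (i k : 'I_m) (j l : 'I_n) :
  mxvec_index i j = mxvec_index k l -> (i, j) = (k, l).
Proof. by move=> /cast_ord_inj /enum_rank_inj. Qed.

Lemma pair_of_mxvec_indexK {m n : nat} (i : 'I_m) (j : 'I_n) :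
  pair_of_mxvec_index (mxvec_indexP (mxvec_index i j)) = (i, j).
Proof.
have E (k : 'I_(m * n)) (x := pair_of_mxvec_index (mxvec_indexP k)) :
    mxvec_index x.1 x.2 = k.
  by rewrite /x; case: (mxvec_indexP k).
have := E (mxvec_index i j); case: (pair_of_mxvec_index _) => a b /=.
by move=> /mxvec_index_inj.
Qed.

Lemma mnm_neq0P {N : nat} (tau : multinom N) :
  (0 < mdeg tau)%N -> exists k sigma, tau = mnm1 k +m sigma.
Proof.
rewrite lt0n => tau0.
have /existsP [k tauk] : [exists k, tau k != 0%N].
  apply: contraR tau0; rewrite negb_exists => /forallP h.
  by rewrite mdegE big1 // => k _; apply/eqP; rewrite -[_ == _]negbK.
by exists k, (mnm_sub tau (mnm1 k)); rewrite addmC submK // lep1mP.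
Qed.

(** Variables are peeled off one by one. Thus every multi-index of degree at most 2r - 2 is a row
    index plus a column index of degree at most r - 1. *)
Lemma mnm_split {N : nat} (s t : nat) (tau : multinom N) :
    (mdeg tau <= s + t)%N ->
  exists a b, [/\ tau = a +m b, (mdeg a <= s)%N & (mdeg b <= t)%N].
Proof.
elim: s tau => [|s IH] tau le_tau; first by exists mnm0, tau; rewrite add0m mdeg0.
have [tau0|/mnm_neq0P [k [sigma tauE]]] := posnP (mdeg tau).
  by exists mnm0, tau; rewrite add0m mdeg0 tau0.
have [|a [b [sigmaE le_a le_b]]] := IH sigma.
  by move: le_tau; rewrite tauE mdegD mdeg1 addSn.
exists (mnm1 k +m a), b; split=> //; first by rewrite tauE sigmaE addmA.
by rewrite mdegD mdeg1.
Qed.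

Section MomentFunctional.
Context {R : realType} {N : nat}.
Implicit Types (h : multinom N -> R) (g : mpoly N R).

(** The Riesz functional of h, linear on polynomials, with value [h gamma] at the monomial of
    exponent gamma. *)
Definition riesz h g : R := \sum_(gamma <- msupp g) mcoeff gamma g * h gamma.

(** Monomials may cancel in a sum of polynomials, so additivity is checked over a common list
    containing all supports. *)
Lemma riesz_widen h g (s : seq (multinom N)) :
    uniq s -> {subset msupp g <= s} ->
  riesz h g = \sum_(gamma <- s) mcoeff gamma g * h gamma.
Proof.
move=> us gs; rewrite (bigID (mem (msupp g))) /= [X in _ + X]big1 ?addr0.
  rewrite -big_filter; apply: perm_big; apply: uniq_perm.
  - exact: msupp_uniq.
  - exact: filter_uniq.
  by move=> x; rewrite mem_filter; case: (boolP (x \in msupp g)) => // /gs ->.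
by move=> x; rewrite -mcoeff_eq0 => /eqP ->; rewrite mul0r.
Qed.

Lemma rieszD h g1 g2 : riesz h (g1 + g2) = riesz h g1 + riesz h g2.
Proof.
pose s := undup (msupp g1 ++ msupp g2).
rewrite !(@riesz_widen _ _ s) ?undup_uniq //.
- by rewrite -big_split; apply: eq_bigr => x _; rewrite /= mcoeffD mulrDl.
- by move=> x xg; rewrite mem_undup mem_cat xg orbT.
- by move=> x xg; rewrite mem_undup mem_cat xg.
- by move=> x /msuppD_le; rewrite mem_undup.
Qed.

Lemma rieszX h tau : riesz h (mpolyX R tau) = h tau.
Proof. by rewrite /riesz msuppX big_seq1 mcoeffX eqxx mul1r. Qed.

Lemma riesz_sum h {I : finType} (g : I -> mpoly N R) :
  riesz h (\sum_i g i) = \sum_i riesz h (g i).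
Proof.
by apply: (big_morph (riesz h) (rieszD h)); rewrite /riesz msupp0 big_nil.
Qed.

Lemma rieszCX h c tau : riesz h (mpolyC N c * mpolyX R tau) = c * h tau.
Proof.
rewrite (@riesz_widen _ _ [:: tau]) // ?big_seq1.
  by rewrite mcoeffCM mcoeffX eqxx mulr1.
move=> x; rewrite mcoeff_msupp mcoeffCM mcoeffX inE.
by case: (eqVneq tau x) => // _; rewrite mulr0 eqxx.
Qed.

Definition momseq_of (t : nat) (v : multinom N -> R) : momseq R N t :=
  [ffun b => v (bmnm b)].

Lemma mom_of t v (tau : multinom N) :
  (mdeg tau <= t)%N -> mom (momseq_of t v) tau = v tau.
Proof.
move=> le_t; rewrite /mom.
by case: insubP => [b _ <-|]; rewrite ?ffunE // ltnS le_t.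
Qed.

Lemma mom_gt {t : nat} (z : momseq R N t) (tau : multinom N) :
  (t < mdeg tau)%N -> mom z tau = 0.
Proof. by move=> lt_t; rewrite /mom insubN // ltnS -ltnNge. Qed.

Lemma locmxE t s g (z : momseq R N t) a b :
  locmx s g z a b =
  riesz (fun gamma => mom z (gamma +m (mnm_of_ord a +m mnm_of_ord b))) g.
Proof. by rewrite mxE; apply: eq_bigr => gamma _; rewrite addmA. Qed.

Lemma mdeg0_lt s : (mdeg (mnm0 : multinom N) < s.+1)%N.
Proof. by rewrite mdeg0. Qed.

Definition ord_of_mnm (s : nat) (tau : multinom N) : 'I_#|{: bmultinom N s.+1}| :=
  enum_rank (insubd (BMultinom (mdeg0_lt s)) tau).

Lemma ord_of_mnmK s tau : (mdeg tau <= s)%N -> mnm_of_ord (ord_of_mnm s tau) = tau.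
Proof. by move=> le_s; rewrite /mnm_of_ord enum_rankK insubdK. Qed.

Lemma mdeg_mnm_of_ord s (a : 'I_#|{: bmultinom N s.+1}|) :
  (mdeg (mnm_of_ord a) <= s)%N.
Proof. by rewrite -ltnS; apply: bmdeg. Qed.

End MomentFunctional.

Lemma eq_psd_kernel {R : realFieldType} {K : Type} (D : pred K)
    (P Q : K -> K -> R) :
  (forall x y, P x y = Q x y) -> psd_kernel D P -> psd_kernel D Q.
Proof.
move=> PQ Ppos s Ds; have := Ppos s Ds; congr (_ <= _).
by apply: eq_bigr => x _; apply: eq_bigr => y _; rewrite PQ.
Qed.

(** A test list becomes a vector by adding up, for each a, the weights of the entries whose index g
    sends to a. *)
Lemma psd_kernel_of_form {R : realFieldType} {K : eqType} {T : finType}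
    (D : pred K) (f : T -> K) (g : K -> T) (P : K -> K -> R) :
    (forall x, D x -> f (g x) = x) ->
    (forall u, 0 <= qform (fun a b => P (f a) (f b)) u) ->
  psd_kernel D P.
Proof.
move=> fgK Ppos s Ds.
have := Ppos (fun a => \sum_(x <- s) x.1 * (g x.2 == a)%:R); congr (_ <= _).
rewrite /qform.
have delta (F : T -> R) x : \sum_a (g x == a)%:R * F a = F (g x).
  rewrite (bigD1 (g x)) //= eqxx mul1r big1 ?addr0 // => a.
  by rewrite eq_sym => /negPf ->; rewrite mul0r.
under eq_bigr => a _.
  under eq_bigr => b _.
    rewrite -mulrA mulr_suml.
    under eq_bigr => x _ do rewrite -mulrA mulr_suml !mulr_sumr.
    over.
  rewrite exchange_big; over.
rewrite exchange_big /= big_seq [RHS]big_seq; apply: eq_bigr => x xs.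
under eq_bigr => a _ do rewrite exchange_big /=.
rewrite exchange_big /= big_seq [RHS]big_seq; apply: eq_bigr => y ys.
have -> :
    \sum_a \sum_b
      x.1 * ((g x.2 == a)%:R * (y.1 * (g y.2 == b)%:R * P (f a) (f b))) =
    x.1 * \sum_a (g x.2 == a)%:R * (y.1 * \sum_b (g y.2 == b)%:R * P (f a) (f b)).
  rewrite mulr_sumr; apply: eq_bigr => a _; rewrite !mulr_sumr.
  by apply: eq_bigr => b _; ring.
by rewrite !delta !fgK ?mulrA //; apply: (allP Ds).
Qed.

Lemma psdmxP {R : realType} {k : nat} (A : 'M[R]_k) :
  psdmx A <-> psd_form (fun a b => A a b).
Proof.
have formE (u : 'cV[R]_k) :
    (u^T *m A *m u) 0 0 = qform (fun a b => A a b) (fun a => u a 0).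
  rewrite mxE; under eq_bigr => b _ do rewrite mxE mulr_suml.
  rewrite exchange_big; apply: eq_bigr => a _; apply: eq_bigr => b _.
  by rewrite mxE; ring.
split=> -[Asym Apos]; split.
- by move=> a b; rewrite -{1}Asym mxE.
- move=> u; have := Apos (\col_a u a); rewrite formE; congr (_ <= _).
  by apply: eq_bigr => a _; apply: eq_bigr => b _; rewrite !mxE.
- by apply/matrixP => a b; rewrite mxE Asym.
- by move=> u; rewrite formE.
Qed.

(** * The feasible set in coordinates *)

Section PseudoMoments.
Context {R : realType} {m n : nat} (alpha : 'I_m -> R) (beta : 'I_n -> R).
Variable r : nat.

(* Pi_r in coordinates.  Squares being absorbed by the rows and columns of the
   localizing matrices, the square-free products e_I can be replaced with
   arbitrary monomials. *)
Definition pseudo_moments (z : multinom (m * n) -> R) : Prop :=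
  [/\ z mnm0 = 1,
      forall kappa, (mdeg kappa <= 2 * r)%N ->
        psd_kernel (fun tau => mdeg tau <= r - uphalf (mdeg kappa))%N
          (fun tau sigma => z (kappa +m (tau +m sigma))),
      forall i tau, (mdeg tau < 2 * r)%N ->
        \sum_j z (mnm_pi i j +m tau) = alpha i * z tau &
      forall j tau, (mdeg tau < 2 * r)%N ->
        \sum_i z (mnm_pi i j +m tau) = beta j * z tau].

Lemma mdeg_mnm_pi (i : 'I_m) (j : 'I_n) : mdeg (mnm_pi i j) = 1%N.
Proof. exact: mdeg1. Qed.

Lemma eq_pseudo_moments z w :
    (forall tau, (mdeg tau <= 2 * r)%N -> z tau = w tau) ->
  pseudo_moments z -> pseudo_moments w.
Proof.
move=> zw [z0 zpsd zr zc]; split.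
- by rewrite -zw ?mdeg0.
- move=> kappa le_kappa s Ds; have := zpsd kappa le_kappa s Ds; congr (_ <= _).
  rewrite big_seq [RHS]big_seq; apply: eq_bigr => x /(allP Ds) /= xs.
  rewrite big_seq [RHS]big_seq; apply: eq_bigr => y /(allP Ds) /= ys.
  (* The degree is at most |kappa| + 2 (r - ceil(|kappa| / 2)) <= 2r. *)
  by rewrite zw // !mdegD; lia.
- move=> i tau lt_tau; rewrite -zw ?(ltnW lt_tau) // -zr //.
  by apply: eq_bigr => j _; rewrite zw // mdegD mdeg_mnm_pi.
- move=> j tau lt_tau; rewrite -zw ?(ltnW lt_tau) // -zc //.
  by apply: eq_bigr => i _; rewrite zw // mdegD mdeg_mnm_pi.
Qed.

Definition mnm_eprod (I : {set 'I_m * 'I_n}) : multinom (m * n) :=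
  \big[mnm_add/mnm0]_(ij in I) mnm_pi ij.1 ij.2.

Lemma eprodE I : eprod R I = mpolyX R (mnm_eprod I).
Proof.
by rewrite /mnm_eprod (big_morph (mpolyX R) (@mpolyXD _ R) (@mpolyX0 _ R)).
Qed.

Lemma mpoly_deg_eprod I : mpoly_deg (eprod R I) = mdeg (mnm_eprod I).
Proof. by rewrite eprodE /mpoly_deg mmeasureX. Qed.

Lemma mnm_eprodE (I : {set 'I_m * 'I_n}) i j :
  mnm_eprod I (mxvec_index i j) = ((i, j) \in I).
Proof.
rewrite /mnm_eprod mnm_sumE.
have inj (x : 'I_m * 'I_n) :
    (mxvec_index x.1 x.2 == mxvec_index i j) = (x == (i, j)).
  by case: x => k l /=; apply/eqP/eqP => [/mxvec_index_inj|[-> ->]].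
under eq_bigr => x _ do rewrite mnm1E inj.
have [ijI|ijI] := boolP ((i, j) \in I).
  by rewrite (bigD1 (i, j)) //= eqxx big1 // => x /andP[_ /negPf ->].
by rewrite big1 // => x xI; case: eqP xI ijI => // -> ->.
Qed.

(** I collects the variables of odd exponent; q halves all exponents, rounding down. *)
Lemma mnm_odd_part (kappa : multinom (m * n)) :
  exists I q, kappa = mnm_eprod I +m (q +m q).
Proof.
exists [set ij | odd (kappa (mxvec_index ij.1 ij.2))].
exists (Multinom [tuple (kappa k)./2 | k < m * n]).
apply/mnmP; case/mxvec_indexP => i j.
by rewrite !mnmDE mnm_eprodE !mnmE inE /= addnn odd_double_half.
Qed.

Lemma riesz_r h i : riesz h (r_ n alpha i) = \sum_j h (mnm_pi i j) - alpha i * h mnm0.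
Proof.
rewrite /r_ -mpolyCN rieszD riesz_sum; congr (_ + _).
  by apply: eq_bigr => j _; rewrite rieszX.
by rewrite -[mpolyC _ _]mulr1 -mpolyX0 rieszCX mulNr.
Qed.

Lemma riesz_c h j : riesz h (c_ m beta j) = \sum_i h (mnm_pi i j) - beta j * h mnm0.
Proof.
rewrite /c_ -mpolyCN rieszD riesz_sum; congr (_ + _).
  by apply: eq_bigr => i _; rewrite rieszX.
by rewrite -[mpolyC _ _]mulr1 -mpolyX0 rieszCX mulNr.
Qed.

Lemma riesz_re h i k l : riesz h (r_ n alpha i * e_ R k l) =
  \sum_j h (mnm_pi i j +m mnm_pi k l) - alpha i * h (mnm_pi k l).
Proof.
rewrite /r_ -mpolyCN mulrDl rieszD mulr_suml riesz_sum rieszCX mulNr.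
by congr (_ + _); apply: eq_bigr => j _; rewrite -mpolyXD rieszX.
Qed.

Lemma riesz_ce h j k l : riesz h (c_ m beta j * e_ R k l) =
  \sum_i h (mnm_pi i j +m mnm_pi k l) - beta j * h (mnm_pi k l).
Proof.
rewrite /c_ -mpolyCN mulrDl rieszD mulr_suml riesz_sum rieszCX mulNr.
by congr (_ + _); apply: eq_bigr => i _; rewrite -mpolyXD rieszX.
Qed.

Hypothesis r_gt0 : (0 < r)%N.

(** Matrices are read entrywise. The equations for r_i and c_j alone cover multipliers of degree at
    most 2r - 2; their products with one variable supply degree 2r - 1. *)
Lemma Pi_rP (z : momseq R (m * n) (2 * r)) :
  Pi_r alpha beta r z <-> pseudo_moments (mom z).
Proof.
have locmx0 g : locmx (r - 1) g z = 0 -> forall tau, (mdeg tau <= 2 * r - 2)%N ->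
    riesz (fun gamma => mom z (gamma +m tau)) g = 0.
  move=> gz tau le_tau.
  have [|a [b [-> le_a le_b]]] := @mnm_split _ (r - 1) (r - 1) tau.
    by lia.
  move/matrixP/(_ (ord_of_mnm (r - 1) a) (ord_of_mnm (r - 1) b)): gz.
  by rewrite locmxE !ord_of_mnmK // mxE.
split=> [[z0 [zpsd [zr [zc [zre zce]]]]]|[z0 zpsd zr zc]]; split=> //.
- move=> kappa; have [I [q ->]] := mnm_odd_part kappa.
  rewrite !mdegD => le_kappa.
  have le_I : (mdeg (mnm_eprod I) <= 2 * r)%N by lia.
  have := zpsd I; rewrite mpoly_deg_eprod => /(_ le_I) /psdmxP [_ psdI].
  set d := (r - _)%N in psdI.
  have psdd : psd_kernel (fun tau => mdeg tau <= d)%N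
      (fun tau sigma => mom z (mnm_eprod I +m (tau +m sigma))).
    refine (psd_kernel_of_form _ (@mnm_of_ord (m * n) d) (ord_of_mnm d) _ _ _).
      by move=> tau; apply: ord_of_mnmK.
    move=> u; have := psdI u; congr (_ <= _).
    apply: eq_bigr => a _; apply: eq_bigr => b _.
    by rewrite locmxE eprodE rieszX.
  (* The square part [q +m q] is shared between rows and columns by the shift of tau to [q +m tau],
     which lowers the admissible degree of tau by that of q. *)
  apply: eq_psd_kernel (psd_kernel_map _ _ (mnm_add q) _ _ psdd).
    by move=> tau sigma; congr (mom z _); apply/mnmP => k; rewrite !mnmDE; lia.
  by move=> tau; rewrite mdegD /d; lia.
- move=> i tau lt_tau.
  have [le_tau|gt_tau] := leqP (mdeg tau) (2 * r - 2).
    have := locmx0 _ (zr i) tau le_tau; rewrite riesz_r add0m => /eqP.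
    by rewrite subr_eq0 => /eqP.
  have [|k [sigma tauE]] := mnm_neq0P tau; first by lia.
  case/mxvec_indexP: k tauE => k l tauE.
  have := locmx0 _ (zre i k l) sigma; rewrite riesz_re -/(mnm_pi k l).
  move: lt_tau; rewrite tauE mdegD mdeg_mnm_pi => lt_sigma.
  move=> /(_ ltac:(lia)) /eqP; rewrite subr_eq0 => /eqP <-.
  by apply: eq_bigr => j _; rewrite addmA.
- move=> j tau lt_tau.
  have [le_tau|gt_tau] := leqP (mdeg tau) (2 * r - 2).
    have := locmx0 _ (zc j) tau le_tau; rewrite riesz_c add0m => /eqP.
    by rewrite subr_eq0 => /eqP.
  have [|k [sigma tauE]] := mnm_neq0P tau; first by lia.
  case/mxvec_indexP: k tauE => k l tauE.
  have := locmx0 _ (zce k j l) sigma; rewrite riesz_ce -/(mnm_pi k l).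
  move: lt_tau; rewrite tauE mdegD mdeg_mnm_pi => lt_sigma.
  move=> /(_ ltac:(lia)) /eqP; rewrite subr_eq0 => /eqP <-.
  by apply: eq_bigr => i _; rewrite addmA.
- have M0 s g (h : forall tau, (mdeg tau <= s + s)%N ->
      riesz (fun gamma => mom z (gamma +m tau)) g = 0) : locmx s g z = 0.
    apply/matrixP => a b; rewrite locmxE mxE h // mdegD.
    by apply: leq_add; apply: mdeg_mnm_of_ord.
  split.
    move=> I; rewrite mpoly_deg_eprod => le_I; apply/psdmxP; split=> [a b|u].
      by rewrite !locmxE [mnm_of_ord a +m _]addmC.
    set s := (r - _)%N.
    have := zpsd _ le_I [seq (u a, mnm_of_ord a) | a <- index_enum _] _.
    rewrite big_map; under eq_bigr do rewrite big_map.
    rewrite -/s => /(_ ltac:(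
      by rewrite all_map; apply/allP => a _; apply: mdeg_mnm_of_ord)).
    congr (_ <= _); apply: eq_bigr => a _; apply: eq_bigr => b _.
    by rewrite locmxE eprodE rieszX.
  split=> [i|]; first apply: M0 => tau le_tau.
    by rewrite riesz_r add0m zr ?subrr //; lia.
  split=> [j|]; first apply: M0 => tau le_tau.
    by rewrite riesz_c add0m zc ?subrr //; lia.
  split=> [i k l|k j l]; apply: M0 => tau le_tau.
    rewrite riesz_re; under eq_bigr do rewrite -addmA.
    by rewrite zr ?subrr // mdegD mdeg_mnm_pi; lia.
  rewrite riesz_ce; under eq_bigr do rewrite -addmA.
  by rewrite zc ?subrr // mdegD mdeg_mnm_pi; lia.
Qed.

End PseudoMoments.

(** * Bounds and vanishing of pseudo-moments *)

Section PseudoMomentBounds.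
Context {R : realType} {m n : nat} {alpha : 'I_m -> R} {beta : 'I_n -> R}.
Context {r : nat} {z : multinom (m * n) -> R}.
Hypothesis zP : pseudo_moments alpha beta r z.

(** The kernel for kappa = tau, tested with weight 1 at the zero multi-index, is [z tau]. *)
Lemma pseudo_moments_ge0 tau : (mdeg tau <= 2 * r)%N -> 0 <= z tau.
Proof.
move=> le_tau; have [_ zpsd _ _] := zP.
have := zpsd tau le_tau [:: (1, mnm0)]; rewrite !big_seq1 !mul1r !addm0 /= mdeg0.
exact.
Qed.

(** Nonnegative terms with sum zero vanish. This makes the convention 0^-1 = 0 harmless in the
    gluing. *)
Lemma pseudo_moments_null_col i j tau :
  beta j = 0 -> (mdeg tau < 2 * r)%N -> z (mnm_pi i j +m tau) = 0.
Proof.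
have [_ _ _ zc] := zP; move=> bj lt_tau.
have /eqP := zc j tau lt_tau; rewrite bj mul0r psumr_eq0.
  by move=> /allP /(_ i) /=; rewrite mem_index_enum => /(_ isT) /eqP.
by move=> k _; rewrite pseudo_moments_ge0 // mdegD mdeg_mnm_pi.
Qed.

Lemma pseudo_moments_null_row i j tau :
  alpha i = 0 -> (mdeg tau < 2 * r)%N -> z (mnm_pi i j +m tau) = 0.
Proof.
have [_ _ zr _] := zP; move=> ai lt_tau.
have /eqP := zr i tau lt_tau; rewrite ai mul0r psumr_eq0.
  by move=> /allP /(_ j) /=; rewrite mem_index_enum => /(_ isT) /eqP.
by move=> k _; rewrite pseudo_moments_ge0 // mdegD mdeg_mnm_pi.
Qed.

(** By induction on the degree: a moment with a factor pi_ij is at most the corresponding row sum,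
    which is [alpha i] times a moment of lower degree. *)
Lemma pseudo_moments_le1 tau :
  (forall i, alpha i <= 1) -> (mdeg tau <= 2 * r)%N -> z tau <= 1.
Proof.
have [z0 _ zr _] := zP; move=> alpha1.
have [d] := ubnP (mdeg tau); elim: d tau => // d IH tau lt_d le_tau.
have [/eqP|/mnm_neq0P [k [sigma tauE]]] := posnP (mdeg tau).
  by rewrite mdeg_eq0 => /eqP ->; rewrite z0.
case/mxvec_indexP: k tauE => i j tauE; rewrite -/(mnm_pi i j) in tauE.
move: lt_d le_tau; rewrite tauE mdegD mdeg_mnm_pi => lt_d lt_sigma.
apply: (@le_trans _ _ (alpha i * z sigma)).
  rewrite -zr // (bigD1 j) //= lerDl sumr_ge0 // => k _.
  by rewrite pseudo_moments_ge0 // mdegD mdeg_mnm_pi.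
have z_ge0 := pseudo_moments_ge0 sigma (ltnW lt_sigma).
by apply: (le_trans (ler_piMl z_ge0 (alpha1 i))); apply: IH; lia.
Qed.

End PseudoMomentBounds.

(** * Product couplings and gluing *)

Section ProductCoupling.
Context {R : realType} {m n : nat} (alpha : 'I_m -> R) (beta : 'I_n -> R).

Definition product_coupling (k : 'I_(m * n)) : R :=
  let ij := pair_of_mxvec_index (mxvec_indexP k) in alpha ij.1 * beta ij.2.

(** The moments of the Dirac mass at x. *)
Definition dirac_moments {N : nat} (x : 'I_N -> R) (tau : multinom N) : R :=
  \prod_k x k ^+ tau k.

Lemma dirac_momentsD {N : nat} (x : 'I_N -> R) tau sigma :
  dirac_moments x (tau +m sigma) = dirac_moments x tau * dirac_moments x sigma.
Proof.
by rewrite -big_split; apply: eq_bigr => k _; rewrite mnmDE exprD.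
Qed.

Lemma dirac_moments_pi i j :
  dirac_moments product_coupling (mnm_pi i j) = alpha i * beta j.
Proof.
rewrite /dirac_moments (bigD1 (mxvec_index i j)) //= mnm1E eqxx expr1 big1.
  by rewrite mulr1 /product_coupling pair_of_mxvec_indexK.
by move=> k /negPf; rewrite eq_sym mnm1E => ->; rewrite expr0.
Qed.

Lemma product_pseudo_moments r :
    (forall i, 0 <= alpha i) -> (forall j, 0 <= beta j) ->
    \sum_i alpha i = 1 -> \sum_j beta j = 1 ->
  pseudo_moments alpha beta r (dirac_moments product_coupling).
Proof.
move=> a0 b0 a1 b1; split.
- by rewrite /dirac_moments big1 // => k _; rewrite mnm0E expr0.
- move=> kappa _ s _; set z := dirac_moments _.
  (* Moments of a Dirac mass are multiplicative, so each kernel is a nonnegative multiple of a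
     rank-one kernel. *)
  have -> : \sum_(x <- s) \sum_(y <- s) x.1 * y.1 * z (kappa +m (x.2 +m y.2)) =
      z kappa * (\sum_(x <- s) x.1 * z x.2) ^+ 2.
    rewrite expr2 big_distrl mulr_sumr; apply: eq_bigr => x _.
    rewrite big_distrr mulr_sumr; apply: eq_bigr => y _.
    by rewrite /z !dirac_momentsD /=; ring.
  rewrite mulr_ge0 ?sqr_ge0 // /z /dirac_moments prodr_ge0 // => k _.
  by rewrite exprn_ge0 // /product_coupling mulr_ge0.
- move=> i tau _; under eq_bigr do rewrite dirac_momentsD dirac_moments_pi.
  by rewrite -mulr_suml -mulr_sumr b1 mulr1.
- move=> j tau _; under eq_bigr do rewrite dirac_momentsD dirac_moments_pi.
  by rewrite -mulr_suml -mulr_suml a1 mul1r.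
Qed.

End ProductCoupling.

Section Gluing.
Context {R : realType} {m n l : nat}.
Variables (alpha : 'I_m -> R) (beta : 'I_n -> R) (gamma : 'I_l -> R).
Variable r : nat.
Variables (z : multinom (m * n) -> R) (w : multinom (n * l) -> R).
Hypothesis beta_ge0 : forall j, 0 <= beta j.
Hypothesis zP : pseudo_moments alpha beta r z.
Hypothesis wP : pseudo_moments beta gamma r w.

Local Notation mnm2 := (multinom (m * n) * multinom (n * l))%type.

Definition mnm2_pi (ik : 'I_m * 'I_l) (j : 'I_n) : mnm2 :=
  (mnm_pi ik.1 j, mnm_pi j ik.2).

Definition mnm2_add (x y : mnm2) : mnm2 := (x.1 +m y.1, x.2 +m y.2).

(* The monomials, with coefficients, of the image of a word of variables under
   the substitution pi_ik := \sum_j pi_ij * pi_jk / beta_j; the convention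
   0^-1 = 0 drops the points j of measure zero. *)
Fixpoint glue_expansion (s : seq ('I_m * 'I_l)) : seq (R * mnm2) :=
  if s is ik :: s' then
    [seq ((beta j)^-1 * x.1, mnm2_add (mnm2_pi ik j) x.2)
       | j <- index_enum 'I_n, x <- glue_expansion s']
  else [:: (1, (mnm0, mnm0))].

(** The linear functional with values F on monomials, applied to the image of the word s. *)
Definition glue_eval s (F : mnm2 -> R) : R :=
  \sum_(x <- glue_expansion s) x.1 * F x.2.

(** The substitution replaces each letter by terms of bidegree (1, 1), with coefficients that are
    nonnegative because beta is. *)
Lemma glue_expansionP s x : x \in glue_expansion s ->
  [/\ 0 <= x.1, mdeg x.2.1 = size s & mdeg x.2.2 = size s].
Proof.
elim: s x => [|ik s IH] x /=.
  by rewrite inE => /eqP -> /=; rewrite !mdeg0 ler01.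
case/allpairsP => -[j y] /= [_ /IH [y0 d1 d2] ->] /=.
by rewrite !mdegD !mdeg_mnm_pi d1 d2 mulr_ge0 ?invr_ge0.
Qed.

Lemma eq_glue_eval s F G :
    (forall x : mnm2, mdeg x.1 = size s -> mdeg x.2 = size s -> F x = G x) ->
  glue_eval s F = glue_eval s G.
Proof.
move=> FG; rewrite /glue_eval big_seq [RHS]big_seq; apply: eq_bigr => x.
by move=> /glue_expansionP [_ d1 d2]; rewrite FG.
Qed.

Lemma glue_evalZ s c F : glue_eval s (fun x => c * F x) = c * glue_eval s F.
Proof. by rewrite /glue_eval mulr_sumr; apply: eq_bigr => x _; rewrite mulrCA. Qed.

Lemma glue_eval_sum {I : Type} s (t : seq I) (F : I -> mnm2 -> R) :
  glue_eval s (fun x => \sum_(i <- t) F i x) = \sum_(i <- t) glue_eval s (F i).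
Proof.
by rewrite /glue_eval exchange_big; apply: eq_bigr => x _; rewrite mulr_sumr.
Qed.

Lemma glue_eval_exchange s t (G : mnm2 -> mnm2 -> R) :
  glue_eval s (fun x => glue_eval t (G x)) =
  glue_eval t (fun y => glue_eval s (fun x => G x y)).
Proof.
rewrite /glue_eval; under eq_bigr do rewrite mulr_sumr.
rewrite exchange_big; apply: eq_bigr => y _; rewrite mulr_sumr.
by apply: eq_bigr => x _; rewrite mulrCA.
Qed.

Lemma glue_eval_cons ik s F : glue_eval (ik :: s) F =
  \sum_j (beta j)^-1 * glue_eval s (fun x => F (mnm2_add (mnm2_pi ik j) x)).
Proof.
rewrite /glue_eval big_allpairs_dep; apply: eq_bigr => j _.
by rewrite mulr_sumr; apply: eq_bigr => x _; rewrite mulrA.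
Qed.

Lemma glue_eval_cat s t F : glue_eval (s ++ t) F =
  glue_eval s (fun x => glue_eval t (fun y => F (mnm2_add x y))).
Proof.
elim: s F => [|ik s IH] F.
  rewrite /= {2}/glue_eval big_seq1 mul1r; apply: eq_glue_eval => -[a b] _ _.
  by rewrite /mnm2_add /= !add0m.
rewrite cat_cons !glue_eval_cons; apply: eq_bigr => j _; rewrite IH.
congr (_ * _); apply: eq_glue_eval => x _ _; apply: eq_glue_eval => y _ _.
by rewrite /mnm2_add /= !addmA.
Qed.

(** Monomials commute, so the value depends only on the monomial that the word spells. It suffices
    to swap the two leading blocks of a word. *)
Lemma glue_eval_perm s t F : perm_eq s t -> glue_eval s F = glue_eval t F.
Proof.
apply: (catCA_perm_subst (F := glue_eval ^~ F)) => s1 s2 s3.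
rewrite !glue_eval_cat; under eq_glue_eval => x _ _ do rewrite glue_eval_cat.
rewrite glue_eval_exchange; apply: eq_glue_eval => y _ _.
rewrite glue_eval_cat; apply: eq_glue_eval => x _ _; apply: eq_glue_eval => u _ _.
by congr F; rewrite /mnm2_add /= !addmA ![_ x.1 y.1]addmC ![_ x.2 y.2]addmC.
Qed.

Definition mnm_word (tau : multinom (m * l)) : seq ('I_m * 'I_l) :=
  [seq pair_of_mxvec_index (mxvec_indexP k) | k <- m2s tau].

Lemma size_mnm_word tau : size (mnm_word tau) = mdeg tau.
Proof. by rewrite size_map size_m2s. Qed.

Lemma count_m2s {N : nat} (tau : multinom N) k : count_mem k (m2s tau) = tau k.
Proof. by rewrite -{2}[tau]s2mK mnmE. Qed.

Lemma mnm_wordD tau sigma :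
  perm_eq (mnm_word (tau +m sigma)) (mnm_word tau ++ mnm_word sigma).
Proof.
rewrite -map_cat; apply: perm_map; apply/allP => k _ /=.
by rewrite count_cat !count_m2s mnmDE.
Qed.

Lemma mnm_word_pi i k : mnm_word (mnm_pi i k) = [:: (i, k)].
Proof.
have /perm_small_eq : perm_eq (m2s (mnm_pi i k)) [:: mxvec_index i k].
  by apply/allP => k' _ /=; rewrite count_m2s mnm1E addn0.
by rewrite /mnm_word => -> //=; rewrite pair_of_mxvec_indexK.
Qed.

Definition tensor_moments (x : mnm2) : R := z x.1 * w x.2.

Definition glue_moments (tau : multinom (m * l)) : R :=
  glue_eval (mnm_word tau) tensor_moments.

Lemma glue_moments_pi i k tau : glue_moments (mnm_pi i k +m tau) =
  glue_eval (mnm_word tau)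
    (fun x => \sum_j (beta j)^-1 * tensor_moments (mnm2_add (mnm2_pi (i, k) j) x)).
Proof.
rewrite /glue_moments (glue_eval_perm _ _ _ (mnm_wordD _ _)) mnm_word_pi.
rewrite glue_eval_cons glue_eval_sum; apply: eq_bigr => j _; exact/esym/glue_evalZ.
Qed.

Lemma glue_moments_pi2 i k i' k' : glue_moments (mnm_pi i k +m mnm_pi i' k') =
  \sum_j \sum_j' (beta j)^-1 * (beta j')^-1
    * (z (mnm_pi i j +m mnm_pi i' j') * w (mnm_pi j k +m mnm_pi j' k')).
Proof.
rewrite glue_moments_pi mnm_word_pi glue_eval_cons exchange_big.
apply: eq_bigr => j' _; rewrite /glue_eval /= big_seq1 mul1r mulr_sumr.
apply: eq_bigr => j _.
by rewrite mulrA [_^-1 * _^-1]mulrC /tensor_moments /= !addm0.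
Qed.

(** When [beta j = 0], both sides vanish because a does; the moments used as a satisfy this by the
    null row and null column lemmas. *)
Lemma beta_mulKl j a b : (beta j = 0 -> a = 0) ->
  (beta j)^-1 * (a * (beta j * b)) = a * b.
Proof.
have [->|bj _] := eqVneq (beta j) 0; first by move=> -> //; rewrite !mul0r mulr0.
by field.
Qed.

(** The term of a glued second moment at fixed intermediate points, with a = (i, i'), b = (j, j')
    and c = (k, k'). *)
Definition glue_weight (a : 'I_m * 'I_m) (b : 'I_n * 'I_n) (c : 'I_l * 'I_l) : R :=
  (beta b.1)^-1 * (beta b.2)^-1 *
    (z (mnm_pi a.1 b.1 +m mnm_pi a.2 b.2) * w (mnm_pi b.1 c.1 +m mnm_pi b.2 c.2)).

Hypothesis r_gt0 : (0 < r)%N.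

Let mdeg_pi_lt (m' n' : nat) (i : 'I_m') (j : 'I_n') : (mdeg (mnm_pi i j) < 2 * r)%N.
Proof. by rewrite mdeg_mnm_pi; lia. Qed.

Lemma glue_weight_ge0 a b c : 0 <= glue_weight a b c.
Proof.
rewrite mulr_ge0 ?mulr_ge0 ?invr_ge0 //.
  by rewrite (pseudo_moments_ge0 zP) // mdegD !mdeg_mnm_pi; lia.
by rewrite (pseudo_moments_ge0 wP) // mdegD !mdeg_mnm_pi; lia.
Qed.

Lemma glue_weight_sum a c :
  \sum_b glue_weight a b c =
  glue_moments (mnm_pi a.1 c.1 +m mnm_pi a.2 c.2).
Proof. by rewrite glue_moments_pi2 pair_bigA. Qed.

(** Two uses of the column equations of z give [beta b.1 * beta b.2], which cancels the inverses;
    where one of these weights is zero, the moment of w vanishes too. *)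
Lemma glue_weight_suml b c :
  \sum_a glue_weight a b c = w (mnm_pi b.1 c.1 +m mnm_pi b.2 c.2).
Proof.
have [z0 _ _ zc] := zP.
rewrite -mulr_sumr -mulr_suml -(pair_bigA _ (fun i i' =>
  z (mnm_pi i b.1 +m mnm_pi i' b.2))) /= exchange_big.
under eq_bigr do rewrite zc //.
rewrite -mulr_sumr; under eq_bigr do rewrite -[mnm_pi _ b.2]addm0.
rewrite zc ?mdeg0; last by lia.
rewrite z0 mulr1 mulrA.
have [b1|b1] := eqVneq (beta b.1) 0.
  by rewrite (pseudo_moments_null_row wP _ _ _ b1) // mulr0.
have [b2|b2] := eqVneq (beta b.2) 0.
  by rewrite addmC (pseudo_moments_null_row wP _ _ _ b2) // mulr0.
by field; rewrite b1 b2.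
Qed.

Lemma glue_weight_sumr a b :
  \sum_c glue_weight a b c = z (mnm_pi a.1 b.1 +m mnm_pi a.2 b.2).
Proof.
have [w0 _ wr _] := wP.
rewrite -!mulr_sumr -(pair_bigA _ (fun k k' =>
  w (mnm_pi b.1 k +m mnm_pi b.2 k'))) /= exchange_big.
under eq_bigr do rewrite wr //.
rewrite -mulr_sumr; under eq_bigr do rewrite -[mnm_pi b.2 _]addm0.
rewrite wr ?mdeg0; last by lia.
rewrite w0 mulr1.
have [b1|b1] := eqVneq (beta b.1) 0.
  by rewrite (pseudo_moments_null_col zP _ _ _ b1) // mul0r mulr0.
have [b2|b2] := eqVneq (beta b.2) 0.
  by rewrite addmC (pseudo_moments_null_col zP _ _ _ b2) // mul0r mulr0.
by field; rewrite b1 b2.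
Qed.

(** For fixed j, the row equation of w summed over k yields the factor [beta j] that cancels its
    inverse; the row equation of z then handles the sum over j. *)
Lemma glue_moments_row i tau : (mdeg tau < 2 * r)%N ->
  \sum_k glue_moments (mnm_pi i k +m tau) = alpha i * glue_moments tau.
Proof.
move=> lt_tau; have [_ _ zr _] := zP; have [_ _ wr _] := wP.
under eq_bigr do rewrite glue_moments_pi.
rewrite -glue_eval_sum -glue_evalZ; apply: eq_glue_eval => x.
rewrite size_mnm_word => d1 d2; rewrite exchange_big /= mulrA -zr ?d1 //.
rewrite mulr_suml; apply: eq_bigr => j _.
rewrite -mulr_sumr /tensor_moments /= -mulr_sumr.
rewrite wr ?d2 // beta_mulKl // => bj.
by apply: (pseudo_moments_null_col zP) => //; rewrite d1.
Qed.

Lemma glue_moments_col k tau : (mdeg tau < 2 * r)%N ->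
  \sum_i glue_moments (mnm_pi i k +m tau) = gamma k * glue_moments tau.
Proof.
move=> lt_tau; have [_ _ _ zc] := zP; have [_ _ _ wc] := wP.
under eq_bigr do rewrite glue_moments_pi.
rewrite -glue_eval_sum -glue_evalZ; apply: eq_glue_eval => x.
rewrite size_mnm_word => d1 d2.
rewrite exchange_big /= mulrCA -wc ?d2 //.
rewrite mulr_sumr; apply: eq_bigr => j _.
rewrite -mulr_sumr /tensor_moments /= -mulr_suml.
rewrite zc ?d1 // [X in _ * X]mulrC beta_mulKl 1?mulrC // => bj.
by apply: (pseudo_moments_null_row wP) => //; rewrite d2.
Qed.

(** Each term of the expansion of kappa contributes, with nonnegative coefficient, the product of a
    kernel of z and a kernel of w. Both kernels have the same degree bound d, since the expansion
    preserves degrees in each factor. *)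
Lemma glue_moments_psd kappa : (mdeg kappa <= 2 * r)%N ->
  psd_kernel (fun tau => mdeg tau <= r - uphalf (mdeg kappa))%N
    (fun tau sigma => glue_moments (kappa +m (tau +m sigma))).
Proof.
move=> le_kappa; set d := (r - _)%N => s Ds.
have [_ zpsd _ _] := zP; have [_ wpsd _ _] := wP.
pose G k p q := tensor_moments (mnm2_add k (mnm2_add p q)).
have -> : \sum_(x <- s) \sum_(y <- s)
      x.1 * y.1 * glue_moments (kappa +m (x.2 +m y.2)) =
    glue_eval (mnm_word kappa) (fun k =>
      \sum_(x <- s) \sum_(y <- s) x.1 * y.1 *
        glue_eval (mnm_word x.2) (fun p => glue_eval (mnm_word y.2) (G k p))).
  rewrite glue_eval_sum; apply: eq_bigr => x _.
  rewrite glue_eval_sum; apply: eq_bigr => y _.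
  rewrite glue_evalZ; congr (_ * _).
  rewrite /glue_moments (glue_eval_perm _ _ _ (mnm_wordD _ _)) glue_eval_cat.
  apply: eq_glue_eval => k _ _.
  by rewrite (glue_eval_perm _ _ _ (mnm_wordD _ _)) glue_eval_cat.
rewrite {1}/glue_eval big_seq sumr_ge0 // => k.
move=> /glue_expansionP; rewrite size_mnm_word => -[k0 d1 d2].
apply: mulr_ge0 => //.
pose D (x : mnm2) := ((mdeg x.1 <= d) && (mdeg x.2 <= d))%N.
have zk : psd_kernel D (fun x y => z (k.2.1 +m (x.1 +m y.1))).
  have := zpsd k.2.1; rewrite d1 => /(_ le_kappa).
  by apply: (psd_kernel_map _ D fst) => x /andP[].
have wk : psd_kernel D (fun x y => w (k.2.2 +m (x.2 +m y.2))).
  have := wpsd k.2.2; rewrite d2 => /(_ le_kappa).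
  by apply: (psd_kernel_map _ D snd) => x /andP[].
have sym N (f : multinom N -> R) (a b c : multinom N) :
  f (a +m (b +m c)) = f (a +m (c +m b)) by rewrite [b +m c]addmC.
(* In the test list, each weighted multi-index is replaced with the terms of its own expansion,
   their coefficients multiplied by its weight. *)
have := psd_kernelM _ _ _ (fun x y => sym _ z _ _ _)
  (fun x y => sym _ w _ _ _) zk wk
  [seq (x.1 * p.1, p.2) | x <- s, p <- glue_expansion (mnm_word x.2)].
rewrite big_allpairs_dep /=.
under eq_bigr => x _ do under eq_bigr => p _ do rewrite big_allpairs_dep /=.
move=> /(_ _)/le_trans; apply; last first.
  rewrite le_eqVlt; apply/orP; left; apply/eqP; apply: eq_bigr => x _.
  rewrite exchange_big; apply: eq_bigr => y _.
  rewrite /glue_eval mulr_sumr; apply: eq_bigr => p _.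
  rewrite !mulr_sumr; apply: eq_bigr => q _.
  by rewrite /G /tensor_moments /=; ring.
apply/allP => _ /allpairsPdep [x [p [/(allP Ds) xs pE ->]]].
have [_ p1 p2] := glue_expansionP _ _ pE.
by rewrite /D /= p1 p2 size_mnm_word andbb.
Qed.

Lemma glue_pseudo_moments : pseudo_moments alpha gamma r glue_moments.
Proof.
split.
- have [z0 _ _ _] := zP; have [w0 _ _ _] := wP.
  rewrite /glue_moments (size0nil (_ : size (mnm_word mnm0) = 0%N)).
    by rewrite /glue_eval big_seq1 /tensor_moments z0 w0 !mul1r.
  by rewrite size_mnm_word mdeg0.
- exact: glue_moments_psd.
- exact: glue_moments_row.
- exact: glue_moments_col.
Qed.

End Gluing.

(** * Attainment of the minima *)

Lemma Pi_r_momseq_of {R : realType} {m n r : nat}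
    (alpha : 'I_m -> R) (beta : 'I_n -> R) (v : multinom (m * n) -> R) :
    (0 < r)%N -> pseudo_moments alpha beta r v ->
  Pi_r alpha beta r (momseq_of (2 * r) v).
Proof.
move=> r0 vP; apply/Pi_rP => //; apply: eq_pseudo_moments vP => tau le_tau.
by rewrite mom_of.
Qed.

Section Existence.
Context {R : realType} {m n : nat} (alpha : 'I_m -> R) (beta : 'I_n -> R).
Variable r : nat.

Local Open Scope classical_set_scope.

Local Notation moments := {ptws multinom (m * n) -> R}.

Let coord_continuous tau : continuous (fun z : moments => z tau).
Proof. exact: (@proj_continuous _ (fun=> R)). Qed.

Let scale_continuous (c : R) (f : moments -> R) :
  continuous f -> continuous (fun z => c * f z).
Proof.
by move=> cf z; apply: (continuous_comp (cf z)); apply: mulrl_continuous.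
Qed.

Let sum_continuous {I : Type} (s : seq I) (f : I -> moments -> R) :
  (forall i, continuous (f i)) -> continuous (fun z => \sum_(i <- s) f i z).
Proof.
by move=> cf; apply: continuous_big => [|i _]; [exact: add_continuous|exact: cf].
Qed.

Let sub_continuous (f g : moments -> R) :
  continuous f -> continuous g -> continuous (fun z => f z - g z).
Proof. by move=> cf cg z; apply: continuousB; [apply: cf|apply: cg]. Qed.

Lemma closed_pseudo_moments :
  closed [set z : moments | pseudo_moments alpha beta r z].
Proof.
(* A set is closed once it is cut out by the continuous functions that are
   nonnegative on it. *)
pose C := [set c : moments -> R | continuous c /\
  forall z, pseudo_moments alpha beta r z -> 0 <= c z].
suff -> : [set z | pseudo_moments alpha beta r z] =
    \bigcap_(c in C) (c @^-1` [set x | 0 <= x]).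
  apply: closed_bigI => c [cc _]; apply: preimage_closed; last exact: closed_ge.
  by move=> z _; apply: cc.
apply/seteqP; split=> [z zP c [_]|z zC]; first exact.
have ge0 (c : moments -> R) : continuous c ->
    (forall z, pseudo_moments alpha beta r z -> 0 <= c z) -> 0 <= c z.
  by move=> cc c0; apply: (zC c).
have eq0 (c d : moments -> R) : continuous c -> continuous d ->
    (forall z, pseudo_moments alpha beta r z -> c z = d z) -> c z = d z.
  move=> cc cd cd0; apply/eqP; rewrite eq_le -subr_ge0 -[X in _ && X]subr_ge0.
  apply/andP; split.
    apply: (ge0 (fun z => d z - c z)) => [|v /cd0 ->]; last by rewrite subrr.
    exact: sub_continuous.
  apply: (ge0 (fun z => c z - d z)) => [|v /cd0 ->]; last by rewrite subrr.
  exact: sub_continuous.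
split.
- apply: (eq0 (fun z => z mnm0) (fun=> 1)) => [||v []] //.
  by move=> v; apply: cst_continuous.
- move=> kappa le_kappa s Ds.
  apply: (ge0 (fun z => \sum_(x <- s) \sum_(y <- s)
    x.1 * y.1 * z (kappa +m (x.2 +m y.2)))).
    apply: sum_continuous => x; apply: sum_continuous => y.
    exact: scale_continuous.
  by move=> v [_ vpsd _ _]; apply: vpsd.
- move=> i tau lt_tau.
  apply: (eq0 (fun z => \sum_j z (mnm_pi i j +m tau))
    (fun z => alpha i * z tau)).
  + by apply: sum_continuous => j.
  + exact: scale_continuous.
  + by move=> v [_ _ vr _]; apply: vr.
- move=> j tau lt_tau.
  apply: (eq0 (fun z => \sum_i z (mnm_pi i j +m tau))
    (fun z => beta j * z tau)).
  + by apply: sum_continuous => i.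
  + exact: scale_continuous.
  + by move=> v [_ _ _ vc]; apply: vc.
Qed.

Hypothesis r_gt0 : (0 < r)%N.
Hypotheses (alpha_ge0 : forall i, 0 <= alpha i) (alpha_sum : \sum_i alpha i = 1).
Hypotheses (beta_ge0 : forall j, 0 <= beta j) (beta_sum : \sum_j beta j = 1).

Lemma Pi_r_minimizer {I : Type} (s : seq I) (c : I -> R)
    (tau : I -> multinom (m * n)) : (forall i, (mdeg (tau i) <= 2 * r)%N) ->
  exists2 z, Pi_r alpha beta r z & forall w, Pi_r alpha beta r w ->
    \sum_(i <- s) c i * mom z (tau i) <= \sum_(i <- s) c i * mom w (tau i).
Proof.
move=> le_tau; have alpha_le1 i : alpha i <= 1.
  by rewrite -alpha_sum (bigD1 i) //= lerDl sumr_ge0.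
(* All coordinates are confined to [0, 1], also those of degree above 2r, where [mom] is 0; so K is
   closed in a Tychonoff cube. *)
pose K := [set z : moments | forall tau, `[0, 1]%classic (z tau)]
  `&` [set z | pseudo_moments alpha beta r z].
have K_mom z : Pi_r alpha beta r z -> K (mom z).
  move=> /Pi_rP-/(_ r_gt0) zP; split=> // sigma; rewrite /= in_itv /=.
  have [le_sigma|gt_sigma] := leqP (mdeg sigma) (2 * r).
    by rewrite (pseudo_moments_ge0 zP) // (pseudo_moments_le1 zP).
  by rewrite mom_gt // lexx ler01.
have K0 : K !=set0.
  exists (mom (momseq_of (2 * r) (dirac_moments (product_coupling alpha beta)))).
  apply: K_mom; apply: Pi_r_momseq_of => //.
  exact: product_pseudo_moments.
have cK : compact K.
  apply: compact_closedI closed_pseudo_moments.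
  apply: (@tychonoff _ (fun=> R) (fun=> `[0, 1]%classic)) => sigma.
  exact: segment_compact.
have cf : continuous (fun z : moments => \sum_(i <- s) c i * z (tau i)).
  by apply: sum_continuous => i; apply: scale_continuous.
have [z /set_mem zK zmin] := compact_EVT_min K0 cK (continuous_subspaceT cf).
exists (momseq_of (2 * r) z) => [|w /K_mom wK].
  by apply: Pi_r_momseq_of => //; case: zK.
under eq_bigr do rewrite mom_of //.
by apply: zmin; apply: mem_set.
Qed.

End Existence.

Section SetMin.
Context {R : realType}.
Local Open Scope classical_set_scope.

(** Nonnegativity of A covers the case without a least element, where [set_min] is 0. *)
Lemma set_min_le (A : set R) v :
  A v -> (forall w, A w -> 0 <= w) -> set_min A <= v.
Proof.
rewrite /set_min => Av A0; case: xgetP => [x _ [_]|_]; last exact: A0.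
exact.
Qed.

Lemma set_minP (A : set R) v : A v -> lbound A v -> set_min A = v.
Proof.
rewrite /set_min => Av lv; case: xgetP => [x _ [Ax lx]|/(_ v)[]] //.
by apply/eqP; rewrite eq_le lx //= lv.
Qed.

End SetMin.

(** * The weights of a space form a probability vector *)

Section Weights.
Context {R : realType} (X : mmSpace R).
Local Open Scope classical_set_scope.

Lemma mm_weight_ge0 (i : 'I_(mm_card X)) : 0 <= mm_weight i.
Proof. exact: fine_ge0. Qed.

Lemma mm_weight_sum : \sum_(i < mm_card X) mm_weight i = 1.
Proof.
pose pt : 'I_(mm_card X) -> borel (mm_carrier X) := @mm_pt R X.
(* Points of a metric space are closed, hence Borel. *)
have m1 i : measurable [set pt i].
  rewrite -[[set _]]setCK; apply: measurableC; apply: sub_sigma_algebra.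
  rewrite /= openC.
  apply: accessible_closed_set1; apply: hausdorff_accessible.
  exact: metric_hausdorff.
have disj : trivIset setT (fun i => [set pt i]).
  by move=> i j _ _ [x [/= -> /(@mm_pt_inj _ X)]].
have := @measure_bigsetU_ord _ _ _ (@mm_measure R X) _ xpredT
  (fun i => [set pt i]) m1 disj.
have -> : \big[setU/set0]_(i < mm_card X) [set pt i] = range pt.
  rewrite -(bigcup_pred predT) -bigcup_imset1; congr (\bigcup_(i in _) _).
  by apply/seteqP; split.
move=> /(etrans (esym (@mm_supported R X))) E.
apply: EFin_inj; rewrite -sumEFin E; apply: eq_bigr => i _.
by rewrite fineK // fin_num_measure.
Qed.

End Weights.

(** * The triangle inequality *)

Section Distortion.
Context {R : realType} (p : R) (r : nat).
Hypothesis r_gt0 : (0 < r)%N.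

Local Open Scope classical_set_scope.

Definition discrepancy (X Y : mmSpace R) (a : 'I_(mm_card X) * 'I_(mm_card X))
    (b : 'I_(mm_card Y) * 'I_(mm_card Y)) : R :=
  `|mm_dist a.1 a.2 - mm_dist b.1 b.2|.

Lemma distortionE (X Y : mmSpace R)
    (z : momseq R (mm_card X * mm_card Y) (2 * r)) :
  distortion p z = \sum_a \sum_b
    discrepancy X Y a b `^ p * mom z (mnm_pi a.1 b.1 +m mnm_pi a.2 b.2).
Proof.
by rewrite /distortion pair_bigA; apply: eq_bigr => a _; rewrite pair_bigA.
Qed.

Lemma distortion_ge0 (X Y : mmSpace R)
    (z : momseq R (mm_card X * mm_card Y) (2 * r)) :
  Pi_r (@mm_weight R X) (@mm_weight R Y) r z -> 0 <= distortion p z.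
Proof.
move=> /Pi_rP-/(_ r_gt0) zP; rewrite distortionE.
apply: sumr_ge0 => a _; apply: sumr_ge0 => b _; rewrite mulr_ge0 ?powR_ge0 //.
by rewrite (pseudo_moments_ge0 zP) // mdegD !mdeg_mnm_pi; lia.
Qed.

(** The distortion is linear in moments of degree 2, and 2 <= 2r as r is positive. *)
Lemma Delta_attained (X Y : mmSpace R) :
  exists2 z, Pi_r (@mm_weight R X) (@mm_weight R Y) r z &
    Delta p r X Y = distortion p z `^ p^-1.
Proof.
pose I := (('I_(mm_card X) * 'I_(mm_card X))
  * ('I_(mm_card Y) * 'I_(mm_card Y)))%type.
have le2 (x : I) : (mdeg (mnm_pi x.1.1 x.2.1 +m mnm_pi x.1.2 x.2.2) <= 2 * r)%N.
  by rewrite mdegD !mdeg_mnm_pi; lia.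
have [z zP zmin] := Pi_r_minimizer _ _ r r_gt0 (@mm_weight_ge0 R X)
  (@mm_weight_sum R X) (@mm_weight_ge0 R Y) (@mm_weight_sum R Y) (index_enum I)
  (fun x => discrepancy X Y x.1 x.2 `^ p) _ le2.
exists z => //; rewrite /Delta; congr (_ `^ _); apply: set_minP; first by exists z.
by move=> _ [w /zmin zw <-]; rewrite !distortionE !pair_bigA.
Qed.

Hypothesis p_ge1 : 1 <= p.

Lemma Delta_le (X Y : mmSpace R) z :
  Pi_r (@mm_weight R X) (@mm_weight R Y) r z ->
  Delta p r X Y <= distortion p z `^ p^-1.
Proof.
have p0 : 0 <= p := le_trans ler01 p_ge1.
have pos w :
    (@distortion R p r X Y @` Pi_r (@mm_weight R X) (@mm_weight R Y) r) w ->
  0 <= w by move=> [v vP <-]; apply: distortion_ge0.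
move=> zP; have zA := imageP (@distortion R p r X Y) zP.
rewrite /Delta ge0_ler_powR ?invr_ge0 ?nnegrE ?distortion_ge0 ?set_min_le //.
rewrite /set_min; case: xgetP => // x _ [xA _]; exact: pos.
Qed.

(** Bounds a, b > 0 stand in for the p-th roots of the distortions, which may be zero, because the
    Minkowski argument divides by them. *)
Lemma distortion_glue (X Y Z : mmSpace R) z w (a b : R) :
    Pi_r (@mm_weight R X) (@mm_weight R Y) r z ->
    Pi_r (@mm_weight R Y) (@mm_weight R Z) r w ->
    0 < a -> 0 < b -> distortion p z <= a `^ p -> distortion p w <= b `^ p ->
  exists2 v, Pi_r (@mm_weight R X) (@mm_weight R Z) r v &
    distortion p v <= (a + b) `^ p.
Proof.
move=> /Pi_rP-/(_ r_gt0) zP /Pi_rP-/(_ r_gt0) wP a0 b0 za wb.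
have beta0 := @mm_weight_ge0 R Y.
pose W := glue_weight (@mm_weight R Y) (mom z) (mom w).
pose v := glue_moments (@mm_weight R Y) (mom z) (mom w).
exists (momseq_of (2 * r) v).
  apply: Pi_r_momseq_of => //.
  exact: (glue_pseudo_moments _ _ _ _ _ _ beta0 zP wP).
have p0 : 0 <= p := le_trans ler01 p_ge1.
pose I := ((('I_(mm_card X) * 'I_(mm_card X)) * ('I_(mm_card Y) * 'I_(mm_card Y)))
  * ('I_(mm_card Z) * 'I_(mm_card Z)))%type.
have sumI (F : _ -> _ -> _ -> R) :
    \sum_(x : I) F x.1.1 x.1.2 x.2 = \sum_x \sum_y \sum_t F x y t.
  rewrite -(pair_bigA _ (fun u t => F u.1 u.2 t)).
  by rewrite -(pair_bigA _ (fun x y => \sum_t F x y t)).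
(* The second moments of v are spread over the intermediate pairs, and the triangle inequality for
   absolute values is applied inside the p-th power. *)
apply: (@le_trans _ _ (\sum_(x : I) W x.1.1 x.1.2 x.2 *
    (discrepancy X Y x.1.1 x.1.2 + discrepancy Y Z x.1.2 x.2) `^ p)).
  rewrite distortionE (sumI (fun x y t => W x y t *
    (discrepancy X Y x y + discrepancy Y Z y t) `^ p)).
  apply: ler_sum => x _; rewrite exchange_big; apply: ler_sum => t _.
  rewrite mom_of; last by rewrite mdegD !mdeg_mnm_pi; lia.
  rewrite /v -(glue_weight_sum _ _ _ beta0) mulr_sumr.
  apply: ler_sum => y _; rewrite mulrC ler_wpM2l //.
    exact: (glue_weight_ge0 _ _ _ _ _ _ beta0 zP wP).
  apply: ge0_ler_powR; rewrite ?nnegrE ?addr_ge0 ?normr_ge0 //.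
  by rewrite /discrepancy; apply: ler_distD.
apply: (minkowski_sum (fun x : I => W x.1.1 x.1.2 x.2)
  (fun x => discrepancy X Y x.1.1 x.1.2)
  (fun x => discrepancy Y Z x.1.2 x.2)) => //.
- by move=> x; apply: (glue_weight_ge0 _ _ _ _ _ _ beta0 zP wP).
- by move=> x; apply: normr_ge0.
- by move=> x; apply: normr_ge0.
- rewrite (sumI (fun x y t => W x y t * discrepancy X Y x y `^ p)).
  apply: le_trans za; rewrite distortionE le_eqVlt; apply/orP; left; apply/eqP.
  apply: eq_bigr => x _; apply: eq_bigr => y _; rewrite -mulr_suml mulrC.
  by rewrite (glue_weight_sumr _ _ _ _ _ _ zP wP).
- rewrite (sumI (fun x y t => W x y t * discrepancy Y Z y t `^ p)).
  apply: le_trans wb; rewrite distortionE le_eqVlt; apply/orP; left; apply/eqP.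
  rewrite exchange_big; apply: eq_bigr => y _; rewrite exchange_big.
  apply: eq_bigr => t _; rewrite -mulr_suml mulrC.
  by rewrite (glue_weight_suml _ _ _ _ _ _ zP wP).
Qed.

End Distortion.

Theorem proposition5p3 (R : realType) (p : R) (r : nat) (p_ge1 : 1 <= p)
    (r_gt0 : (0 < r)%N) (X Y Z : mmSpace R) :
  Delta p r X Z <= Delta p r X Y + Delta p r Y Z.
Proof.
have p_gt0 : 0 < p := lt_le_trans ltr01 p_ge1.
have [z zP zE] := Delta_attained p r r_gt0 X Y.
have [w wP wE] := Delta_attained p r r_gt0 Y Z.
have powK (x : R) : 0 <= x -> (x `^ p^-1) `^ p = x.
  by move=> x0; rewrite -powRrM mulVf ?powRr1 // gt_eqF.
have powVK (x : R) : 0 <= x -> (x `^ p) `^ p^-1 = x.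
  by move=> x0; rewrite -powRrM divff ?powRr1 // gt_eqF.
(* A slack of e / 2 in each summand makes both bounds strictly positive, as the gluing requires. *)
apply/ler_addgt0Pl => e e0.
have e2 : 0 < e / 2 by lra.
have D0 (t : R) : 0 < t `^ p^-1 + e / 2 by rewrite ltr_wpDl ?powR_ge0.
have Dle (t : R) : 0 <= t -> t <= (t `^ p^-1 + e / 2) `^ p.
  move=> t0; rewrite -{1}[t]powK //.
  rewrite ge0_ler_powR ?nnegrE ?powR_ge0 ?(ltW p_gt0) ?(ltW (D0 t)) //.
  by rewrite lerDl ltW.
have [v vP vle] := distortion_glue p r r_gt0 p_ge1 X Y Z z w _ _ zP wP
  (D0 _) (D0 _) (Dle _ (distortion_ge0 p r r_gt0 _ _ _ zP))
  (Dle _ (distortion_ge0 p r r_gt0 _ _ _ wP)).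
apply: (le_trans (Delta_le p r r_gt0 p_ge1 _ _ _ vP)).
have -> : e + (Delta p r X Y + Delta p r Y Z) =
    ((distortion p z `^ p^-1 + e / 2 + (distortion p w `^ p^-1 + e / 2)) `^ p)
      `^ p^-1.
  by rewrite powVK; [rewrite zE wE; field|rewrite addr_ge0 ?ltW].
have v_ge0 := distortion_ge0 p r r_gt0 _ _ _ vP.
by rewrite ge0_ler_powR ?nnegrE ?powR_ge0 ?invr_ge0 ?(ltW p_gt0).
Qed.
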